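(* Let $D$ be a real $m\times p$ matrix and let $\rho>0$. Suppose that $S\subseteq\mathbb{R}^m$ is a nonempty closed and convex set and that the loss $f:\mathbb{R}^p\to\mathbb{R}$ is $L$-smooth and $\mu$-strongly convex with $\mu>0$. Then the objective $$h_\rho(x)=f(x)+\frac{\rho}{2}\operatorname{dist}(Dx,S)^2$$ possesses a unique minimum point $z_\rho$, and for any $x_0\in\mathbb{R}^p$ the proximal distance iterates $$x_{n+1}=\operatorname{argmin}_{x\in\mathbb{R}^p}\Big[f(x)+\frac{\rho}{2}\|Dx-\mathcal{P}(Dx_n)\|^2\Big]$$ satisfy, for all $n\ge 0$, $$0\ \le\ h_\rho(x_n)-h_\rho(z_\rho)\ \le\ \Big[1-\frac{\mu^2}{2(L+\rho\|D\|^2)^2}\Big]^n\,[h_\rho(x_0)-h_\rho(z_\rho)] .$$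
   Context: $\mathcal{P}(z)$ is the Euclidean projection of $z$ onto $S$, $\operatorname{dist}(z,S)=\|z-\mathcal{P}(z)\|$, and $\|D\|$ is the spectral norm of $D$. $f$ is $L$-smooth if it is differentiable and $\|\nabla f(x)-\nabla f(y)\|\le L\|x-y\|$ for all $x,y$; it is $\mu$-strongly convex if $f-\frac{\mu}{2}\|\cdot\|^2$ is convex. *)

(* Defs.v *)
From HB Require Import structures.
From mathcomp Require Import all_boot all_order all_algebra.
From mathcomp Require Import all_classical all_reals all_analysis.

Set Implicit Arguments.
Unset Strict Implicit.
Unset Printing Implicit Defensive.

Import Order.TTheory GRing.Theory Num.Theory.
Import numFieldNormedType.Exports.

Local Open Scope classical_set_scope.
Local Open Scope ring_scope.

(* Vectors of R^n are columns 'cV[R]_n. The library norm `|x| on matrices is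
   the max norm, so the Euclidean norm is defined separately; the two norms are
   equivalent, hence the library notions [closed] and [differentiable] are the
   usual ones. *)
Definition enorm (R : realType) (n : nat) (x : 'cV[R]_n) : R :=
  Num.sqrt (\sum_(i < n) x i 0 ^+ 2).

(* The operator norm induced by the Euclidean norms. *)
Definition spectral_norm (R : realType) (m p : nat) (D : 'M[R]_(m, p)) : R :=
  sup [set enorm (D *m x) | x in [set x : 'cV[R]_p | enorm x <= 1]].

Definition is_minimum_point (R : realType) (T : Type) (A : set T) (g : T -> R)
    (x : T) : Prop :=
  A x /\ forall y, A y -> g x <= g y.

(* [get] returns an arbitrary vector when no minimum point exists. *)
Definition argmin (R : realType) (n : nat) (A : set 'cV[R]_n)
    (g : 'cV[R]_n -> R) : 'cV[R]_n :=
  get [set x | is_minimum_point A g x].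

Definition proj (R : realType) (m : nat) (S : set 'cV[R]_m) (z : 'cV[R]_m) :
    'cV[R]_m :=
  argmin S (fun y => enorm (z - y)).

Definition dist (R : realType) (m : nat) (S : set 'cV[R]_m) (z : 'cV[R]_m) : R :=
  enorm (z - proj S z).

Definition gradient (R : realType) (p : nat) (f : 'cV[R]_p -> R)
    (x : 'cV[R]_p) : 'cV[R]_p :=
  \col_(i < p) 'D_(delta_mx i 0) f x.

Definition smooth (R : realType) (p : nat) (L : R) (f : 'cV[R]_p -> R) : Prop :=
  (forall x, differentiable f x) /\
  (forall x y, enorm (gradient f x - gradient f y) <= L * enorm (x - y)).

Definition strongly_convex (R : realType) (p : nat) (mu : R)
    (f : 'cV[R]_p -> R) : Prop :=
  @convex_function R 'cV[R]_p setT (fun x => f x - mu / 2 * enorm x ^+ 2).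

Definition objective (R : realType) (m p : nat) (D : 'M[R]_(m, p))
    (S : set 'cV[R]_m) (f : 'cV[R]_p -> R) (rho : R) (x : 'cV[R]_p) : R :=
  f x + rho / 2 * dist S (D *m x) ^+ 2.

Definition surrogate (R : realType) (m p : nat) (D : 'M[R]_(m, p))
    (S : set 'cV[R]_m) (f : 'cV[R]_p -> R) (rho : R) (y x : 'cV[R]_p) : R :=
  f x + rho / 2 * enorm (D *m x - proj S (D *m y)) ^+ 2.

(* Main.v *)
(* The surrogate g(. | x) majorizes h and agrees with it at x.  Comparing its
   minimum point y with the trial point x + t (z - x), 0 <= t <= 1, gives
     h(y) <= h(x) + t <q, z - x> + t^2 (L + rho |D|^2 / 2) |z - x|^2,
   where q = grad f(x) + rho D^T (Dx - P(Dx)), while strong convexity gives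
     h(x) + <q, z - x> + mu/2 |z - x|^2 <= h(z).
   For t = mu / (2L + rho |D|^2) the quadratic terms cancel and the gap is
   multiplied by at most 1 - t, which is below the announced rate because
   mu <= L.  The crude constant L instead of L/2 in the first inequality, which
   the mean value theorem yields directly, is affordable for this reason.
   Existence and uniqueness of all minimum points (of h, of the surrogates, and
   of the projection) follow from a single fact: a function satisfying
   g(x) + <q_x, y - x> + c |y - x|^2 <= g(y) with c > 0 has Cauchy minimizing
   sequences in closed convex sets. *)

Require Import Defs.
From HB Require Import structures.
From mathcomp Require Import all_boot all_order all_algebra.
From mathcomp Require Import all_classical all_reals all_analysis.
From mathcomp Require Import ring lra.

Set Implicit Arguments.
Unset Strict Implicit.
Unset Printing Implicit Defensive.

Import Order.TTheory GRing.Theory Num.Theory.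
Import numFieldNormedType.Exports.

Local Open Scope classical_set_scope.
Local Open Scope ring_scope.

(* [proj] alone would denote the coordinate projections of product spaces. *)
Local Notation proj := Defs.proj.

(** * Euclidean inner product, norm and operator bound *)

Section EuclideanSpace.
Variable R : realType.

Definition dot (n : nat) (u v : 'cV[R]_n) : R := \sum_(i < n) u i 0 * v i 0.

Lemma dotC n (u v : 'cV[R]_n) : dot u v = dot v u.
Proof. by apply: eq_bigr => i _; rewrite mulrC. Qed.

Lemma dotDl n (u v w : 'cV[R]_n) : dot (u + v) w = dot u w + dot v w.
Proof. by rewrite -big_split; apply: eq_bigr => i _; rewrite mxE mulrDl. Qed.

Lemma dotZl n (a : R) (u v : 'cV[R]_n) : dot (a *: u) v = a * dot u v.
Proof. by rewrite mulr_sumr; apply: eq_bigr => i _; rewrite mxE mulrA. Qed.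

Lemma dotNl n (u v : 'cV[R]_n) : dot (- u) v = - dot u v.
Proof. by rewrite -scaleN1r dotZl mulN1r. Qed.

Lemma dotDr n (u v w : 'cV[R]_n) : dot w (u + v) = dot w u + dot w v.
Proof. by rewrite dotC dotDl !(dotC w). Qed.

Lemma dotZr n (a : R) (u v : 'cV[R]_n) : dot v (a *: u) = a * dot v u.
Proof. by rewrite dotC dotZl (dotC v). Qed.

Lemma dotNr n (u v : 'cV[R]_n) : dot v (- u) = - dot v u.
Proof. by rewrite dotC dotNl (dotC v). Qed.

Lemma dot_trmx_mul m n (D : 'M[R]_(m, n)) (u : 'cV[R]_m) (v : 'cV[R]_n) :
  dot (D^T *m u) v = dot u (D *m v).
Proof.
rewrite /dot.
under eq_bigr do rewrite mxE mulr_suml.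
under [RHS]eq_bigr do rewrite mxE mulr_sumr.
rewrite exchange_big; apply: eq_bigr => i _; apply: eq_bigr => j _.
by rewrite mxE; ring.
Qed.

Lemma enorm_ge0 n (u : 'cV[R]_n) : 0 <= enorm u.
Proof. exact: sqrtr_ge0. Qed.

Lemma enorm_sqr n (u : 'cV[R]_n) : enorm u ^+ 2 = dot u u.
Proof.
rewrite sqr_sqrtr; first by apply: eq_bigr => i _; rewrite expr2.
by apply: sumr_ge0 => i _; exact: sqr_ge0.
Qed.

Lemma enorm_sqrD n (u v : 'cV[R]_n) :
  enorm (u + v) ^+ 2 = enorm u ^+ 2 + 2 * dot u v + enorm v ^+ 2.
Proof. by rewrite !enorm_sqr !dotDl !dotDr (dotC v u); ring. Qed.

Lemma enormZ n (a : R) (u : 'cV[R]_n) : enorm (a *: u) = `|a| * enorm u.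
Proof.
apply: (pexpIrn (n := 2)) => //; rewrite ?nnegrE ?mulr_ge0 ?enorm_ge0 //.
by rewrite exprMn real_normK ?num_real // !enorm_sqr dotZl dotZr; ring.
Qed.

Lemma enormN n (u : 'cV[R]_n) : enorm (- u) = enorm u.
Proof. by rewrite -scaleN1r enormZ normrN1 mul1r. Qed.

Lemma enorm0 n : enorm (0 : 'cV[R]_n) = 0.
Proof. by rewrite -(scale0r 0) enormZ normr0 mul0r. Qed.

Lemma coord_le_enorm n (u : 'cV[R]_n) i : `|u i 0| <= enorm u.
Proof.
rewrite -sqrtr_sqr ler_sqrt; last by apply: sumr_ge0 => j _; exact: sqr_ge0.
by rewrite (bigD1 i) //= lerDl sumr_ge0 // => j _; exact: sqr_ge0.
Qed.

Lemma enorm_eq0 n (u : 'cV[R]_n) : enorm u = 0 -> u = 0.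
Proof.
move=> u0; apply/colP => i; rewrite [RHS]mxE; apply/eqP.
by rewrite -normr_le0 -u0 coord_le_enorm.
Qed.

(** Expand [| |v| u - |u| v |^2 >= 0] and divide by [2 |u| |v|]; the degenerate cases come first. *)
Lemma cauchy_schwarz n (u v : 'cV[R]_n) : dot u v <= enorm u * enorm v.
Proof.
have [/enorm_eq0 u0|u_neq0] := eqVneq (enorm u) 0.
  by rewrite u0 -(scale0r 0) dotZl enormZ normr0 !mul0r.
have [/enorm_eq0 v0|v_neq0] := eqVneq (enorm v) 0.
  by rewrite v0 -(scale0r 0) dotZr enormZ normr0 !(mul0r, mulr0).
have uv_gt0 : 0 < enorm u * enorm v by rewrite mulr_gt0 // lt_def enorm_ge0 andbT.
have := sqr_ge0 (enorm (enorm v *: u - enorm u *: v)).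
rewrite enorm_sqrD enormN !enormZ !ger0_norm ?enorm_ge0 // dotNr dotZl dotZr.
move=> le0; rewrite -(ler_pM2l uv_gt0); lra.
Qed.

(** Makes the set whose [sup] is [spectral_norm] bounded, so that this [sup] is a genuine least
    upper bound. *)
Lemma enorm_mulmx_bounded m n (D : 'M[R]_(m, n)) :
  exists C, forall u, enorm (D *m u) <= C * enorm u.
Proof.
(* The Frobenius norm works, by Cauchy-Schwarz on each row. *)
exists (Num.sqrt (\sum_(i < m) enorm (row i D)^T ^+ 2)) => u.
rewrite -(ler_pXn2r (n := 2)) ?nnegrE ?mulr_ge0 ?enorm_ge0 ?sqrtr_ge0 //.
rewrite exprMn sqr_sqrtr; last by apply: sumr_ge0 => i _; exact: sqr_ge0.
rewrite sqr_sqrtr; last by apply: sumr_ge0 => i _; exact: sqr_ge0.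
rewrite mulr_suml; apply: ler_sum => i _.
have -> : (D *m u) i 0 = dot (row i D)^T u.
  by rewrite mxE; apply: eq_bigr => j _; rewrite !mxE.
rewrite -exprMn -[X in X <= _]real_normK ?num_real //.
rewrite ler_pXn2r ?nnegrE ?mulr_ge0 ?enorm_ge0 // ler_norml cauchy_schwarz andbT.
by rewrite lerNl -dotNl -[enorm _]enormN cauchy_schwarz.
Qed.

Lemma enorm_mulmx_le m n (D : 'M[R]_(m, n)) (u : 'cV[R]_n) :
  enorm (D *m u) <= spectral_norm D * enorm u.
Proof.
have [/enorm_eq0 ->|u_neq0] := eqVneq (enorm u) 0.
  by rewrite mulmx0 !enorm0 mulr0.
have u_gt0 : 0 < enorm u by rewrite lt_def u_neq0 enorm_ge0.
rewrite -ler_pdivrMr // mulrC -[X in X * _]ger0_norm ?invr_ge0 ?enorm_ge0 //.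
rewrite -enormZ scalemxAr; apply: ub_le_sup; last first.
  exists ((enorm u)^-1 *: u) => //=.
  by rewrite enormZ ger0_norm ?invr_ge0 ?enorm_ge0 // mulVf.
have [C HC] := enorm_mulmx_bounded D.
exists `|C| => _ [v /= v1 <-]; apply: le_trans (HC v) _.
apply: le_trans (ler_wpM2r (enorm_ge0 v) (ler_norm C)) _.
by rewrite ler_piMr.
Qed.

Lemma continuous_dot n (q : 'cV[R]_n) : continuous (dot q).
Proof.
move=> x; apply: (@cvg_big _ _ +%R 0 xpredT _ _ (nbhs x) _
  (fun i (u : 'cV[R]_n) => q i 0 * u i 0)); first exact: add_continuous.
by move=> i _; apply: cvgM; [exact: cvg_cst|exact: coord_continuous].
Qed.

End EuclideanSpace.

(** * Strong subgradient inequalities and existence of minimum points *)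

(** Here [c] multiplies the whole square: [c = mu / 2] matches [mu]-strong convexity, and [c = 0]
    gives ordinary subgradients. *)
Definition subgradient (R : realType) (n : nat) (c : R) (g : 'cV[R]_n -> R)
    (x q : 'cV[R]_n) : Prop :=
  forall y, g x + dot q (y - x) + c * enorm (y - x) ^+ 2 <= g y.

Section Subgradients.
Variable R : realType.

(** Average the inequalities at [x] and [y]: the displacements from the midpoint are opposite, so
    the linear terms cancel. *)
Lemma subgradient_midpoint n (c : R) (g : 'cV[R]_n -> R) (x y q : 'cV[R]_n) :
  subgradient c g (2^-1 *: (x + y)) q ->
  g (2^-1 *: (x + y)) + c / 4 * enorm (x - y) ^+ 2 <= (g x + g y) / 2.
Proof.
move=> Hq; have := Hq x; have := Hq y.
have -> : y - 2^-1 *: (x + y) = (- 2^-1) *: (x - y).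
  by apply/colP => i; rewrite !mxE; field.
have -> : x - 2^-1 *: (x + y) = 2^-1 *: (x - y).
  by apply/colP => i; rewrite !mxE; field.
rewrite !dotZr !enormZ normrN ger0_norm ?invr_ge0 //; lra.
Qed.

(** Completing the square minimizes the quadratic lower bound over [y]. *)
Lemma subgradient_bounded_below n (c : R) (g : 'cV[R]_n -> R) (x q : 'cV[R]_n) :
  0 < c -> subgradient c g x q ->
  forall y, g x - enorm q ^+ 2 / (4 * c) <= g y.
Proof.
move=> c_gt0 Hq y; apply: le_trans (Hq y).
have := sqr_ge0 (enorm (q + (2 * c) *: (y - x))).
rewrite enorm_sqrD dotZr enormZ ger0_norm; last by rewrite mulr_ge0 // ltW.
move=> H; have c4_gt0 : 0 < 4 * c by rewrite mulr_gt0.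
rewrite -addrA lerD2l lerNl ler_pdivlMr //; lra.
Qed.

Lemma subgradient_quadratic n (c : R) (b x : 'cV[R]_n) : c <= 1 ->
  subgradient c (fun y => enorm (y - b) ^+ 2) x (2 *: (x - b)).
Proof.
move=> c_le1 y; have -> : y - b = (x - b) + (y - x).
  by apply/colP => i; rewrite !mxE; ring.
rewrite [leRHS]enorm_sqrD dotZl lerD2l.
by rewrite ler_piMl ?sqr_ge0.
Qed.

Lemma subgradientD_comp m n (c a : R) (D : 'M[R]_(m, n)) (g : 'cV[R]_n -> R)
    (k : 'cV[R]_m -> R) (x q : 'cV[R]_n) (r : 'cV[R]_m) :
  0 <= a -> subgradient c g x q -> subgradient 0 k (D *m x) r ->
  subgradient c (fun y => g y + a * k (D *m y)) x (q + a *: (D^T *m r)).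
Proof.
move=> a_ge0 Hg Hk y; have := Hg y; have := Hk (D *m y).
rewrite -mulmxBr mul0r addr0 -dot_trmx_mul dotDl dotZl => /(ler_wpM2l a_ge0).
lra.
Qed.

(* The subgradient inequality also supplies the lower semicontinuity needed in
   the limit, so no continuity assumption is made on [g]. *)
Lemma strongly_convex_minimum n (c : R) (A : set 'cV[R]_n) (g : 'cV[R]_n -> R) :
  0 < c -> (forall x, exists q, subgradient c g x q) ->
  A !=set0 -> closed A -> (forall x y, A x -> A y -> A (2^-1 *: (x + y))) ->
  exists! z, is_minimum_point A g z.
Proof.
move=> c_gt0 Hg [a Aa] A_closed A_mid.
have mid x y : exists w, (A x -> A y -> A w) /\
    g w + c / 4 * enorm (x - y) ^+ 2 <= (g x + g y) / 2.
  exists (2^-1 *: (x + y)); split; first exact: A_mid.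
  by have [q /subgradient_midpoint] := Hg (2^-1 *: (x + y)).
have c4_gt0 : 0 < c / 4 by rewrite divr_gt0.
have lbg : has_lbound (g @` A).
  have [q Hq] := Hg a; exists (g a - enorm q ^+ 2 / (4 * c)) => _ [y _ <-].
  exact: subgradient_bounded_below Hq y.
have gA_inf : has_inf (g @` A) by split => //; exists (g a), a.
pose I := inf (g @` A).
have leI y : A y -> I <= g y by move=> Ay; apply: ge_inf => //; exists y.
have /choice[u Hu] : forall k : nat, exists y, A y /\ g y < I + k.+1%:R^-1.
  move=> k; have k_gt0 : (0 : R) < k.+1%:R^-1 by rewrite invr_gt0.
  by have [_ [y Ay <-] lty] := inf_adherent k_gt0 gA_inf; exists y.
have gu_small e : 0 < e -> \forall k \near \oo, g (u k) < I + e.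
  move=> e_gt0; near=> k; have [_ /lt_trans] := Hu k; apply; rewrite ltrD2l.
  by near: k; exact: (near_infty_natSinv_lt (PosNum e_gt0)).
have u_cauchy : cauchy (u @ \oo).
  apply: cauchy_exP => e e_gt0.
  (* If two values lie below [I + c / 4 * e ^+ 2], the midpoint inequality and [I <= g w] force the
     points to be closer than [e]. *)
  have d_gt0 : 0 < c / 4 * e ^+ 2 by rewrite mulr_gt0 // exprn_gt0.
  have [N _ HN] := gu_small _ d_gt0.
  exists (u N); exists N => // k /= leNk.
  have [w [Aw Hw]] := mid (u N) (u k).
  have lt_e : enorm (u N - u k) < e.
    rewrite -(ltr_pXn2r (n := 2)) ?nnegrE ?enorm_ge0 ?ltW // -(ltr_pM2l c4_gt0).
    have := leI _ (Aw (Hu N).1 (Hu k).1).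
    have := HN N (leqnn N); have := HN k leNk => /=; lra.
  (* Balls are those of the max norm, hence the coordinatewise bound. *)
  split => // i j; rewrite ord1 /ball /=; apply: le_lt_trans lt_e.
  by have := coord_le_enorm (u N - u k) i; rewrite !mxE.
have /cvg_ex[z uz] : cvg (u @ \oo) by exact: cauchy_cvg.
have Az : A z by apply: closed_cvg uz => //; near=> k; exact: (Hu k).1.
have gz_le : g z <= I.
  (* In the subgradient inequality at [z], the linear term at [u k] tends to 0 and the square is
     nonnegative. *)
  apply/ler_addgt0Pr => e e_gt0; have [q Hq] := Hg z.
  have e2_gt0 : 0 < e / 2 by rewrite divr_gt0.
  have /cvgrPdist_lt/(_ _ e2_gt0) Hdot := cvg_comp _ _ uz (@continuous_dot _ _ q z).
  have [k] : exists k, `|dot q z - dot q (u k)| < e / 2 /\ g (u k) < I + e / 2.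
    near \oo => k; exists k; split; near: k; [exact: Hdot|exact: gu_small].
  move=> [/ltr_normlP[_]]; have := Hq (u k).
  rewrite dotDr dotNr; have := mulr_ge0 (ltW c_gt0) (sqr_ge0 (enorm (u k - z))).
  lra.
have z_min : is_minimum_point A g z.
  by split => // y Ay; exact: le_trans gz_le (leI _ Ay).
(* Two distinct minimum points would have a midpoint of smaller value. *)
exists z; split => // y [Ay y_min]; have [w [Aw]] := mid z y.
have := y_min _ (Aw Az Ay); have := z_min.2 _ Ay; have := y_min _ Az => h1 h2 h3 h4.
apply/eqP; rewrite -subr_eq0; apply/eqP/enorm_eq0/eqP; rewrite -sqrf_eq0.
rewrite eq_le sqr_ge0 andbT -(ler_pM2l c4_gt0) mulr0; lra.
Unshelve. all: by end_near. Qed.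

End Subgradients.

(** * Projection onto a closed convex set and the squared distance *)

Section Projection.
Variables (R : realType) (m : nat) (S : set 'cV[R]_m).
Hypotheses (S_neq0 : S !=set0) (S_closed : closed S).
Hypothesis S_convex : @convex_set R 'cV[R]_m S.

Lemma convex_set_comb x y (t : R) :
  0 <= t -> t <= 1 -> S x -> S y -> S (t *: x + (1 - t) *: y).
Proof.
move=> t0 t1 Sx Sy.
by have /set_mem := S_convex (Itv01 t0 t1) (mem_set Sx) (mem_set Sy).
Qed.

(** The squared distance to [z] is strongly convex with [c = 1], so a minimum point exists and [get]
    returns one. *)
Lemma proj_min z : is_minimum_point S (fun y => enorm (z - y)) (proj S z).
Proof.
have [|||||p [[Sp p_min] _]] :=
    @strongly_convex_minimum R m 1 S (fun y => enorm (y - z) ^+ 2) => //.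
- by move=> x; exists (2 *: (x - z)); exact: subgradient_quadratic.
- move=> x y Sx Sy.
  have -> : 2^-1 *: (x + y) = 2^-1 *: x + (1 - 2^-1) *: y.
    by rewrite scalerDr; congr (_ + _ *: _); field.
  by apply: convex_set_comb => //; lra.
- apply: (getI (x := p)); split; first exact: Sp.
  move=> y Sy; rewrite -[leLHS]enormN -[leRHS]enormN !opprB.
  rewrite -(ler_pXn2r (n := 2)) ?nnegrE ?enorm_ge0 //; exact: p_min.
Qed.

(** Compare the projection with nearby points of the segment towards [y], divide by [t] and let [t]
    tend to 0. *)
Lemma proj_variational z y : S y -> dot (z - proj S z) (y - proj S z) <= 0.
Proof.
move=> Sy; have [Sp p_min] := proj_min z.
set u := z - proj S z; set v := y - proj S z.
have small t : 0 < t -> t <= 1 -> 2 * dot u v <= t * enorm v ^+ 2.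
  move=> t_gt0 t_le1; have := p_min _ (convex_set_comb (ltW t_gt0) t_le1 Sy Sp).
  have -> : z - (t *: y + (1 - t) *: proj S z) = u + (- t) *: v.
    by apply/colP => i; rewrite !mxE; ring.
  rewrite -(ler_pXn2r (n := 2)) ?nnegrE ?enorm_ge0 //.
  rewrite (enorm_sqrD u) dotZr enormZ normrN gtr0_norm // => le; rewrite -(ler_pM2l t_gt0); lra.
rewrite -(pmulr_rle0 _ (ltr0n R 2)); apply/ler_addgt0Pr => e e_gt0.
have d_gt0 : 0 < enorm v ^+ 2 + 1 by rewrite ltr_wpDl // sqr_ge0.
(* The limit is made explicit: [t = e / (|v|^2 + 1)] when this is at most 1, and [t = 1]
   otherwise. *)
have [e_le|e_gt] := leP e (enorm v ^+ 2 + 1).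
  apply: le_trans (small (e / (enorm v ^+ 2 + 1)) _ _) _.
  - by rewrite divr_gt0.
  - by rewrite ler_pdivrMr // mul1r.
  - by rewrite mulrAC ler_pdivrMr // add0r ler_pM2l // lerDl.
by apply: le_trans (small 1 ltr01 (lexx _)) _; lra.
Qed.

(** With residuals [u] at [z] and [w] at [y], the variational inequality gives
    [dot u (y - z) <= dot u w - |u|^2]; conclude by [|u - w|^2 >= 0]. *)
Lemma dist_sqr_subgradient z :
  subgradient 0 (fun y => dist S y ^+ 2) z (2 *: (z - proj S z)).
Proof.
move=> y; rewrite mul0r addr0 /dist dotZl.
have [Sy _] := proj_min y; have := proj_variational z Sy.
set u := z - proj S z; set w := y - proj S y.
have -> : proj S y - proj S z = (y - z) + u - w.
  by apply/colP => i; rewrite !mxE; ring.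
clearbody u w; have := sqr_ge0 (enorm (u - w)); rewrite (enorm_sqrD u) enormN !dotDr !dotNr.
rewrite -enorm_sqr; lra.
Qed.

Lemma dist_sqr_le z s : S s -> dist S z ^+ 2 <= enorm (z - s) ^+ 2.
Proof.
move=> Ss; rewrite ler_pXn2r ?nnegrE ?enorm_ge0 //; exact: (proj_min z).2.
Qed.

End Projection.

(** * First-order bounds for smooth strongly convex functions *)

Section SmoothStronglyConvex.
Variables (R : realType) (p : nat) (f : 'cV[R]_p -> R) (L mu : R).
Hypothesis f_smooth : smooth L f.

Lemma derive_gradient x v : 'D_v f x = dot (gradient f x) v.
Proof.
have [df _] := f_smooth.
rewrite deriveE // {1}(_ : v = \sum_i v i 0 *: delta_mx i 0); last first.
  by rewrite {1}[v]matrix_sum_delta; apply: eq_bigr => i _; rewrite big_ord1.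
rewrite linear_sum; apply: eq_bigr => i _.
by rewrite linearZ mxE deriveE //= mulrC.
Qed.

Lemma line_derivative x v (t : R) :
  is_derive t 1 (fun s => f (x + s *: v)) (dot (gradient f (x + t *: v)) v).
Proof.
have E : (fun h : R => h^-1 *: (f (x + (h *: (1 : R) + t) *: v) - f (x + t *: v)))
       = (fun h : R => h^-1 *: (f (h *: v + (x + t *: v)) - f (x + t *: v))).
  apply/funext => h; congr (_ *: (f _ - _)).
  by rewrite scalerDl -mulr_algl scaler1 mulr1 addrCA.
have [df _] := f_smooth.
split; first by rewrite /derivable E; exact: diff_derivable.
by rewrite -derive_gradient /derive E.
Qed.

Lemma smooth_taylor x v :
  `|f (x + v) - f x - dot (gradient f x) v| <= L * enorm v ^+ 2.
Proof.
have [|c] := @MVT R (fun t => f (x + t *: v))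
    (fun t => dot (gradient f (x + t *: v)) v) 0 1 ltr01
    (fun t _ => line_derivative x v t).
  apply: continuous_subspaceT => t.
  apply/differentiable_continuous/derivable1_diffP.
  by have := line_derivative x v t => ?; exact: ex_derive.
rewrite in_itv /= => /andP[c_gt0 c_lt1].
rewrite scale1r scale0r addr0 subr0 mulr1 => ->; rewrite -dotNl -dotDl.
set d := _ - _; have dv : `|dot d v| <= enorm d * enorm v.
  by rewrite ler_norml cauchy_schwarz andbT lerNl -dotNl -[enorm d]enormN cauchy_schwarz.
apply: le_trans dv _; have := f_smooth.2 (x + c *: v) x.
rewrite addrAC subrr add0r enormZ gtr0_norm // -/d => Hd.
(* The Lipschitz bound itself gives [0 <= L * enorm v], which allows the factor [c < 1] to be
   dropped. *)
have : 0 <= L * (c * enorm v) by apply: le_trans Hd; exact: enorm_ge0.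
rewrite mulrCA pmulr_rge0 // => Lv_ge0.
have v_ge0 := enorm_ge0 v.
apply: le_trans (ler_wpM2r v_ge0 Hd) _.
by rewrite expr2 mulrA ler_wpM2r // mulrCA ler_piMl // ltW.
Qed.

Hypothesis f_convex : strongly_convex mu f.

(** The last term is the convexity defect of [mu / 2 * |.|^2] along the segment. *)
Lemma strongly_convex_comb x y (t : R) : 0 <= t -> t <= 1 ->
  f (y + t *: (x - y)) <=
  t * f x + (1 - t) * f y - mu / 2 * (t * (1 - t)) * enorm (x - y) ^+ 2.
Proof.
move=> t0 t1.
have : f (t *: x + (1 - t) *: y) - mu / 2 * enorm (t *: x + (1 - t) *: y) ^+ 2
    <= t * (f x - mu / 2 * enorm x ^+ 2) + (1 - t) * (f y - mu / 2 * enorm y ^+ 2).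
  exact: f_convex (Itv01 t0 t1) _ _ (in_setT x) (in_setT y).
have -> : t *: x + (1 - t) *: y = y + t *: (x - y).
  by apply/colP => i; rewrite !mxE; ring.
rewrite enorm_sqrD enormZ exprMn real_normK ?num_real // dotZr.
have : enorm x ^+ 2 = enorm y ^+ 2 + 2 * dot y (x - y) + enorm (x - y) ^+ 2.
  by rewrite -enorm_sqrD addrC subrK.
move=> ->; lra.
Qed.

(** Combine convexity on the segment from [x] to [y] with the Taylor bound at [x + t v] and divide
    by [t]; the error is [t (L + mu / 2) |v|^2], arbitrarily small. *)
Lemma strongly_convex_subgradient x :
  subgradient (mu / 2) f x (gradient f x).
Proof.
move=> y; set v := y - x; apply/ler_addgt0Pr => e e_gt0.
have small t : 0 < t -> t <= 1 ->
  f x + dot (gradient f x) v + mu / 2 * enorm v ^+ 2 <=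
  f y + t * ((L + mu / 2) * enorm v ^+ 2).
  move=> t_gt0 t_le1; have := strongly_convex_comb y x (ltW t_gt0) t_le1.
  have /ler_normlP[+ _] := smooth_taylor x (t *: v).
  rewrite -/v dotZr enormZ gtr0_norm // => h1 h2.
  rewrite -(ler_pM2l t_gt0); lra.
set k := (L + mu / 2) * enorm v ^+ 2 in small.
have k_gt0 : 0 < `|k| + 1 by rewrite ltr_wpDl.
pose t := Num.min 1 (e / (`|k| + 1)).
have t_gt0 : 0 < t by rewrite lt_min ltr01 divr_gt0.
apply: le_trans (small t t_gt0 _) _; first by rewrite ge_min lexx.
rewrite lerD2l; apply: le_trans (_ : t * (`|k| + 1) <= _).
  by rewrite ler_pM2l //; apply: le_trans (ler_norm k) _; rewrite lerDl.
by rewrite -ler_pdivlMr // ge_min lexx orbT.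
Qed.

(** Adding the subgradient inequalities between [0] and [v] gives [mu |v|^2 <= dot (gradient f v -
    gradient f 0) v <= L |v|^2]. *)
Lemma strong_convexity_le_smoothness (v : 'cV[R]_p) : v != 0 -> mu <= L.
Proof.
move=> v_neq0; have v_gt0 : 0 < enorm v.
  by rewrite lt_def enorm_ge0 andbT; apply: contra_neq v_neq0 => /enorm_eq0.
have := strongly_convex_subgradient 0 v; have := strongly_convex_subgradient v 0.
rewrite subr0 sub0r dotNr enormN => h1 h2.
have h3 := cauchy_schwarz (gradient f v - gradient f 0) v.
have := ler_wpM2r (ltW v_gt0) (f_smooth.2 v 0); rewrite subr0 => h4.
rewrite dotDl dotNl in h3.
rewrite -(ler_pM2r (exprn_gt0 2 v_gt0)); lra.
Qed.

End SmoothStronglyConvex.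

(** * Majorization and one-step contraction *)

Section ProximalDistance.
Variables (R : realType) (m p : nat) (D : 'M[R]_(m, p)) (rho : R).
Variables (S : set 'cV[R]_m) (f : 'cV[R]_p -> R) (L mu : R).
Hypotheses (rho_gt0 : 0 < rho) (S_neq0 : S !=set0) (S_closed : closed S).
Hypothesis S_convex : @convex_set R 'cV[R]_m S.
Hypotheses (f_smooth : smooth L f) (f_convex : strongly_convex mu f).

Let rho2_ge0 : 0 <= rho / 2.
Proof. by rewrite divr_ge0 // ltW. Qed.

Lemma objective_subgradient x : subgradient (mu / 2) (objective D S f rho) x
  (gradient f x + (rho / 2) *: (D^T *m (2 *: (D *m x - proj S (D *m x))))).
Proof.
apply: (@subgradientD_comp _ _ _ _ _ D f (fun y => dist S y ^+ 2)) => //.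
  exact: strongly_convex_subgradient f_smooth f_convex x.
exact: dist_sqr_subgradient.
Qed.

Lemma surrogate_subgradient y x :
  subgradient (mu / 2) (surrogate D S f rho y) x
  (gradient f x + (rho / 2) *: (D^T *m (2 *: (D *m x - proj S (D *m y))))).
Proof.
apply: (@subgradientD_comp _ _ _ _ _ D f
  (fun u => enorm (u - proj S (D *m y)) ^+ 2)) => //.
  exact: strongly_convex_subgradient f_smooth f_convex x.
exact: subgradient_quadratic.
Qed.

Lemma objective_le_surrogate y x :
  objective D S f rho x <= surrogate D S f rho y x.
Proof.
rewrite /objective /surrogate lerD2l; apply: ler_wpM2l; first exact: rho2_ge0.
have [Sy _] := proj_min S_neq0 S_closed S_convex (D *m y).
exact: dist_sqr_le Sy.
Qed.

(** The penalty expands exactly, with quadratic term [rho / 2 * |D v|^2]; only [f] needs the Taylor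
    bound. *)
Lemma surrogate_upper_bound x v :
  surrogate D S f rho x (x + v) <= objective D S f rho x +
  dot (gradient f x + (rho / 2) *: (D^T *m (2 *: (D *m x - proj S (D *m x))))) v
  + (L + rho / 2 * spectral_norm D ^+ 2) * enorm v ^+ 2.
Proof.
rewrite /surrogate /objective /dist dotDl dotZl dot_trmx_mul dotZl.
have -> : D *m (x + v) - proj S (D *m x) = (D *m x - proj S (D *m x)) + D *m v.
  by rewrite mulmxDr addrAC.
rewrite [enorm (_ + D *m v) ^+ 2]enorm_sqrD.
have /ler_normlP[_] := smooth_taylor f_smooth x v.
have : enorm (D *m v) ^+ 2 <= (spectral_norm D * enorm v) ^+ 2.
  have le := enorm_mulmx_le D v.
  by rewrite ler_pXn2r ?nnegrE ?enorm_ge0 // (le_trans (enorm_ge0 _) le).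
rewrite exprMn => /(ler_wpM2l rho2_ge0); lra.
Qed.

Hypothesis mu_gt0 : 0 < mu.

Lemma contraction_rate_ge0 : mu <= L ->
  0 <= 1 - mu ^+ 2 / (2 * (L + rho * spectral_norm D ^+ 2) ^+ 2).
Proof.
move=> le_muL; set d := rho * _.
have d_ge0 : 0 <= d by rewrite mulr_ge0 ?sqr_ge0 // ltW.
have Ld_gt0 : 0 < L + d by rewrite ltr_pwDl // (lt_le_trans mu_gt0).
have : mu ^+ 2 <= (L + d) ^+ 2.
  by rewrite ler_pXn2r ?nnegrE ?(ltW mu_gt0) ?(ltW Ld_gt0) //; apply: le_trans le_muL _; rewrite lerDl.
rewrite subr_ge0 ler_pdivrMr ?mulr_gt0 ?exprn_gt0 // mul1r => /le_trans; apply.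
by rewrite ler_peMl ?sqr_ge0 // ler1n.
Qed.

Lemma objective_contraction x y z :
  is_minimum_point setT (objective D S f rho) z ->
  is_minimum_point setT (surrogate D S f rho x) y ->
  objective D S f rho y - objective D S f rho z <=
  (1 - mu ^+ 2 / (2 * (L + rho * spectral_norm D ^+ 2) ^+ 2)) *
    (objective D S f rho x - objective D S f rho z).
Proof.
move=> [_ z_min] [_ y_min].
have le_t t : objective D S f rho y <= surrogate D S f rho x (x + t *: (z - x)).
  by apply: le_trans (objective_le_surrogate x y) _; exact: y_min.
(* A nonzero [z - x] provides [mu <= L]; otherwise the gap at [x] is already 0. *)
have [zx|zx] := eqVneq (z - x) 0.
  have -> : z = x by exact: subr0_eq.
  rewrite [X in _ * X]subrr mulr0 subr_le0.
  by apply: le_trans (objective_le_surrogate x y) _; exact: y_min.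
have le_muL := strong_convexity_le_smoothness f_smooth f_convex zx.
have L_gt0 := lt_le_trans mu_gt0 le_muL.
set d := rho * spectral_norm D ^+ 2.
have d_ge0 : 0 <= d by rewrite mulr_ge0 ?sqr_ge0 // ltW.
pose t := mu / (2 * L + d).
have K_gt0 : 0 < 2 * L + d by rewrite ltr_pwDl // mulr_gt0.
have t_gt0 : 0 < t by rewrite divr_gt0.
have tK : t * (2 * L + d) = mu by rewrite divfK // gt_eqF.
have step : objective D S f rho y - objective D S f rho z <=
    (1 - t) * (objective D S f rho x - objective D S f rho z).
  have := objective_subgradient x z; have := surrogate_upper_bound x (t *: (z - x)).
  rewrite dotZr enormZ gtr0_norm // exprMn.
  set q := dot _ (z - x); set e := enorm (z - x) ^+ 2.
  have -> : (L + rho / 2 * spectral_norm D ^+ 2) * (t ^+ 2 * e) = t * (mu / 2 * e).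
    by rewrite -tK /d; field.
  clearbody q e => h2 /(ler_wpM2l (ltW t_gt0)) h3.
  move: (objective D S f rho x) (objective D S f rho y) (objective D S f rho z)
    (surrogate D S f rho x _) (le_t t) h2 h3 => a b c s; lra.
apply: le_trans step _; apply: ler_wpM2r; first by rewrite subr_ge0 z_min.
rewrite lerD2l lerN2 ler_pdivrMr; last by rewrite mulr_gt0 // exprn_gt0 // ltr_pwDl.
(* After cancelling [t], the rate comparison follows from [mu <= L + d] and
   [2 L + d <= 2 (L + d)]. *)
have -> : mu ^+ 2 = t * (mu * (2 * L + d)) by rewrite mulrCA tK expr2.
rewrite ler_pM2l // expr2 mulrCA; apply: ler_pM; rewrite ?(ltW mu_gt0) ?(ltW K_gt0) //; lra.
Qed.

End ProximalDistance.

(** * Linear convergence of the iterates *)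

Theorem proposition3p4 (R : realType) (m p : nat) (D : 'M[R]_(m, p)) (rho : R)
    (S : set 'cV[R]_m) (f : 'cV[R]_p -> R) (L mu : R)
    (rho_gt0 : 0 < rho)
    (S_neq0 : S !=set0) (S_closed : closed S)
    (S_convex : @convex_set R 'cV[R]_m S)
    (f_smooth : smooth L f)
    (mu_gt0 : 0 < mu) (f_convex : strongly_convex mu f) :
  let h := objective D S f rho in
  (exists! z, is_minimum_point setT h z) /\
  (forall y, exists! x, is_minimum_point setT (surrogate D S f rho y) x) /\
  (forall (z : 'cV[R]_p) (x : nat -> 'cV[R]_p),
     is_minimum_point setT h z ->
     (forall n : nat, x n.+1 = argmin setT (surrogate D S f rho (x n))) ->
     forall n : nat,
       0 <= h (x n) - h z /\
       h (x n) - h z <=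
         (1 - mu ^+ 2 / (2 * (L + rho * spectral_norm D ^+ 2) ^+ 2)) ^+ n *
           (h (x 0%N) - h z)).
Proof.
move=> h.
have mu2_gt0 : 0 < mu / 2 by rewrite divr_gt0.
have minimum (g : 'cV[R]_p -> R) :
    (forall x, exists q, subgradient (mu / 2) g x q) ->
    exists! z, is_minimum_point setT g z.
  move=> Hg; apply: (strongly_convex_minimum mu2_gt0 Hg) => //; by exists 0.
have surrogate_min y : exists! x, is_minimum_point setT (surrogate D S f rho y) x.
  apply: minimum => x; eexists.
  exact: (surrogate_subgradient D S rho_gt0 f_smooth f_convex).
split.
  apply: minimum => x; eexists.
  exact: (objective_subgradient D rho_gt0 S_neq0 S_closed S_convex f_smooth f_convex).
split=> // z x z_min x_iter n.
have h_ge0 k : 0 <= h (x k) - h z by rewrite subr_ge0; exact: z_min.2.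
split=> //.
have contraction k : h (x k.+1) - h z <=
    (1 - mu ^+ 2 / (2 * (L + rho * spectral_norm D ^+ 2) ^+ 2)) * (h (x k) - h z).
  have [w [w_min _]] := surrogate_min (x k).
  (* Existence of [w] ensures that [argmin] is not the default value of [get]. *)
  have next_min : is_minimum_point setT (surrogate D S f rho (x k)) (x k.+1).
    by rewrite x_iter; exact: getI w_min.
  exact: (objective_contraction rho_gt0 S_neq0 S_closed S_convex f_smooth f_convex
    mu_gt0 z_min next_min).
(* In dimension 0 the rate may be negative, but all gaps vanish. Otherwise it is nonnegative, as the
   induction requires. *)
have [[v v_neq0]|no_vector] := pselect (exists v : 'cV[R]_p, v != 0); last first.
  suff all_eq : forall u v : 'cV[R]_p, u = v.
    by rewrite (all_eq (x n) z) (all_eq (x 0%N) z) subrr mulr0.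
  move=> u v; apply: contrapT => uv; apply: no_vector; exists (u - v).
  by rewrite subr_eq0; exact/eqP.
have rate_ge0 := contraction_rate_ge0 D rho_gt0 mu_gt0
  (strong_convexity_le_smoothness f_smooth f_convex v_neq0).
move: (1 - _) rate_ge0 contraction => r r_ge0 contraction.
elim: n => [|n IHn]; first by rewrite expr0 mul1r.
by apply: le_trans (contraction n) _; rewrite exprS -mulrA ler_wpM2l.
Qed.
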